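(* Every finite-dimensional unital Jordan algebra over $\mathbb{R}$ without nilpotent elements is a Baer Jordan algebra.
   Context: For a Jordan algebra $A$ put $A_+=\{a^2: a\in A\}$, $U_a b=2(ab)a-a^2b$ and $U_a(A)=\{U_ax : x\in A\}$ for $a,b\in A$. For a subset $S\subseteq A$ put $S^\perp=\{a\in A: U_a x=0 \text{ for all } x\in S\}$. An idempotent is an element $e$ with $e^2=e$. $A$ is called a Baer Jordan algebra if for every subset $S\subseteq A_+$ there exists an idempotent $e\in A$ such that $S^\perp=U_e(A)$. ''Without nilpotent elements'' means that $0$ is the only element $a$ with $a^n=0$ for some $n\ge 1$. *)

(* Defs.v *)
From mathcomp Require Import all_boot all_order all_algebra sesquilinear.
From mathcomp Require Import boolp classical_sets reals.

Set Implicit Arguments.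
Unset Strict Implicit.
Unset Printing Implicit Defensive.

Import GRing.Theory.

Local Open Scope classical_set_scope.
Local Open Scope ring_scope.

Section JordanAlgebras.
Variables (K : fieldType) (A : lmodType K) (mul : {bilinear A -> A -> A}).

Local Notation "a ∘ b" := (mul a b) (at level 40, left associativity).

Definition is_jordan : Prop :=
  (forall a b, a ∘ b = b ∘ a) /\
  (forall a b, ((a ∘ a) ∘ b) ∘ a = (a ∘ a) ∘ (b ∘ a)).

Definition is_unital : Prop :=
  exists u, forall a, u ∘ a = a /\ a ∘ u = a.

(* The n-th power for n >= 1: a^1 = a and a^(n+1) = a ∘ a^n.  The value at
   n = 0 is irrelevant. *)
Definition jpow (a : A) (n : nat) : A := iter n.-1 (mul a) a.

Definition jnilpotent (a : A) : Prop := exists2 n, (1 <= n)%N & jpow a n = 0.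

Definition jidempotent (e : A) : Prop := e ∘ e = e.

Definition jsquares : set A := [set a ∘ a | a in [set: A]].

Definition jU (a b : A) : A := 2 *: ((a ∘ b) ∘ a) - (a ∘ a) ∘ b.

Definition jperp (S : set A) : set A := [set a | forall x, S x -> jU a x = 0].

(* The Baer condition; it defines Baer Jordan algebras among the products
   satisfying [is_jordan]. *)
Definition is_baer : Prop :=
  forall S : set A, S `<=` jsquares ->
    exists2 e, jidempotent e & jperp S = [set jU e x | x in [set: A]].

End JordanAlgebras.

(* Main.v *)
(** For y in A let t_y be the support idempotent of y, i.e. the unit of the
    algebra of polynomials in y without constant term, which exists because A
    has no nilpotent elements.  Let N be the set of the elements orthogonal to
    every t_y with y^2 in S.  It is a subalgebra, so it has a unit e, and the
    claim is that S^perp = N = U_e(A).  If U_a(y^2) = 0 and s is the support of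
    a, then U_s(y^2) = 0, because a is invertible in U_s(A); the point is to
    deduce that s is orthogonal to y.

    By splitting s one may assume s primitive; write y = y_1 + v + y_0 in its
    Peirce decomposition, so that y_1^2 + E_1(v^2) = 0, where E_1 projects onto
    A_1(s).  Each element of A_1(s) generates a copy of R or C.  If
    v in A_1/2(s) and E_1(v^2) = -s, then v^2 = -s - g with g an idempotent, and
    s - g + v is a nonzero element of square 0; moreover E_1(v^2) = 0 implies
    v = 0.  Thus E_1(v^2) is never a nonpositive multiple of s when v <> 0.  If
    A_1(s) contains j with j^2 = -s, then v, a polynomial multiple of v or j v
    violates this, so that v = 0 and y_1^2 = 0.  Otherwise A_1(s) = R s and
    E_1(v^2) = - y_1^2 is a nonpositive multiple of s, hence v = 0 and y_1 = 0. *)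

Require Import Defs.
From mathcomp Require Import all_boot all_order all_algebra sesquilinear.
From mathcomp Require Import boolp classical_sets reals complex lra ring.

Set Implicit Arguments.
Unset Strict Implicit.
Unset Printing Implicit Defensive.

Import Order.TTheory GRing.Theory Num.Theory.
Local Open Scope ring_scope.

Section Jordan.
Variables (R : realType) (A : vectType R) (mul : {bilinear A -> A -> A}).
Local Notation "a ∘ b" := (mul a b) (at level 40, left associativity).

(** * Bilinearity, and reduction of vector identities to scalar ones *)

Lemma dual_ext (x y : A) :
  (forall f : A -> R, (forall a b, f (a + b) = f a + f b) ->
     (forall k a, f (k *: a) = k * f a) -> f x = f y) -> x = y.
Proof.
move=> H; rewrite (coord_vbasis (memvf x)) (coord_vbasis (memvf y)).
apply: eq_bigr => i _; congr (_ *: _).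
by apply: H => [a b|k a]; rewrite ?linearD ?linearZ.
Qed.

Lemma jmulDl a b c : (a + b) ∘ c = a ∘ c + b ∘ c.
Proof. exact: linearDl. Qed.
Lemma jmulDr a b c : a ∘ (b + c) = a ∘ b + a ∘ c.
Proof. exact: linearDr. Qed.
Lemma jmulNl a c : (- a) ∘ c = - (a ∘ c).
Proof. exact: linearNl. Qed.
Lemma jmulNr a c : a ∘ (- c) = - (a ∘ c).
Proof. exact: linearNr. Qed.
Lemma jmulZl k a c : (k *: a) ∘ c = k *: (a ∘ c).
Proof. exact: linearZl_LR. Qed.
Lemma jmulZr k a c : a ∘ (k *: c) = k *: (a ∘ c).
Proof. exact: linearZr_LR. Qed.
Lemma jmul0l c : 0 ∘ c = 0.
Proof. exact: linear0l. Qed.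
Lemma jmul0r c : c ∘ 0 = 0.
Proof. exact: linear0r. Qed.
Definition jmulE :=
  (jmulDl, jmulDr, jmulNl, jmulNr, jmulZl, jmulZr, jmul0l, jmul0r).

Ltac apply_to_eqs f := repeat match goal with
  | H : _ |- _ => apply (congr1 f) in H; revert H end.

(* Turns vector equations into scalar ones by applying an arbitrary linear
   form, whose values become atoms for [lra]. *)
Ltac vec := try rewrite !jmulE;
  let f := fresh "f" in let fD := fresh "fD" in let fZ := fresh "fZ" in
  apply: dual_ext => f fD fZ;
  let fN := fresh "fN" in let f0 := fresh "f0" in
  assert (fN : forall x, f (- x) = - f x) by
    (move=> ?; rewrite -scaleN1r fZ mulN1r //);
  assert (f0 : f 0 = 0) by rewrite -(scale0r 0) fZ mul0r //;
  apply_to_eqs f;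
  try rewrite !(fD, fN, fZ, f0); intros; lra.

Hypothesis jordan : is_jordan mul.

(** * Linearised Jordan identities *)

Lemma jmulC a b : a ∘ b = b ∘ a. Proof. by case: jordan. Qed.

Lemma jordan_lin a b c d :
  ((a ∘ c) ∘ b) ∘ d + ((c ∘ d) ∘ b) ∘ a + ((d ∘ a) ∘ b) ∘ c =
  (a ∘ c) ∘ (b ∘ d) + (c ∘ d) ∘ (b ∘ a) + (d ∘ a) ∘ (b ∘ c).
Proof.
have J x : ((x ∘ x) ∘ b) ∘ x = (x ∘ x) ∘ (b ∘ x) by case: jordan.
(* The part of degree one in x and two in y: add the identity at x + y and at x - y, subtract twice
   that at x, and halve. *)
have J2 x y : ((y ∘ y) ∘ b) ∘ x + 2 *: (((x ∘ y) ∘ b) ∘ y) =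
              (y ∘ y) ∘ (b ∘ x) + 2 *: ((x ∘ y) ∘ (b ∘ y)).
  have := J (x + y); have := J (x - y); have := J x.
  rewrite !(jmulDl, jmulDr, jmulNl, jmulNr) (jmulC y x); clear; move=> *.
  vec.
have := J2 a (c + d); have := J2 a c; have := J2 a d.
rewrite !(jmulDl, jmulDr) (jmulC d c) (jmulC d a); clear; move=> *.
vec.
Qed.

(** Commutator form of the polarised identity: with L_x the multiplication by x, it is a cyclic sum
    of [L_(a ∘ c), L_d]. It yields [peirce_opcomm] and [opcomm_sq]. *)
Lemma jordan_comm a c d x :
  d ∘ ((a ∘ c) ∘ x) + a ∘ ((c ∘ d) ∘ x) + c ∘ ((d ∘ a) ∘ x) =
  (a ∘ c) ∘ (d ∘ x) + (c ∘ d) ∘ (a ∘ x) + (d ∘ a) ∘ (c ∘ x).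
Proof.
rewrite (jmulC d (_ ∘ _)) (jmulC a (_ ∘ x)) (jmulC c (_ ∘ x)).
by rewrite (jmulC d x) (jmulC a x) (jmulC c x) jordan_lin.
Qed.

(** [jordan_lin] with d = x, read as an operator identity that reduces L_((a ∘ c) ∘ b) to
    multiplications by shorter products. *)
Lemma jordan_op a b c x :
  ((a ∘ c) ∘ b) ∘ x + a ∘ (b ∘ (c ∘ x)) + c ∘ (b ∘ (a ∘ x)) =
  (a ∘ c) ∘ (b ∘ x) + (a ∘ b) ∘ (c ∘ x) + (c ∘ b) ∘ (a ∘ x).
Proof.
rewrite (jmulC a (_ ∘ _)) (jmulC c (_ ∘ (_ ∘ _))) (jmulC b (c ∘ x)).
rewrite (jmulC b (a ∘ x)) (jmulC a x) (jordan_lin a b c x).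
by rewrite (jmulC _ (b ∘ a)) (jmulC (x ∘ a)) (jmulC b a) (jmulC b c).
Qed.

(** * Peirce decomposition with respect to an idempotent *)

Definition opcomm x y := forall z, x ∘ (y ∘ z) = y ∘ (x ∘ z).

(** The scalar k is arbitrary because some elements are shown to vanish by placing them in an
    eigenspace with k outside {0, 1/2, 1}. *)
Definition peirce e k x := e ∘ x = k *: x.

Lemma peirceD e k x y : peirce e k x -> peirce e k y -> peirce e k (x + y).
Proof. by rewrite /peirce jmulDr scalerDr => -> ->. Qed.

Lemma peirceZ e k l x : peirce e k x -> peirce e k (l *: x).
Proof. by rewrite /peirce jmulZr => ->; rewrite !scalerA mulrC. Qed.

Lemma peirceN e k x : peirce e k x -> peirce e k (- x).
Proof. by rewrite /peirce jmulNr scalerN => ->. Qed.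

Lemma peirce_uniq e k l x : k != l -> peirce e k x -> peirce e l x -> x = 0.
Proof.
move=> kl H1 H2; apply/eqP; have /eqP : (k - l) *: x = 0.
  by rewrite scalerBl -H1 -H2 subrr.
by rewrite scaler_eq0 subr_eq0 (negPf kl).
Qed.

Section Peirce.
Variable e : A.
Hypothesis idem : jidempotent mul e.

Lemma idem_cubic x : e ∘ x + 2 *: (e ∘ (e ∘ (e ∘ x))) = 3 *: (e ∘ (e ∘ x)).
Proof. have := jordan_op e e e x; rewrite !idem => H; vec. Qed.

(** The polynomial is k(2k - 1)(k - 1), and [idem_cubic] says that it annihilates L_e. *)
Lemma peirce_eigen k x :
  2 * k ^+ 3 - 3 * k ^+ 2 + k != 0 -> peirce e k x -> x = 0.
Proof.
move=> k0 ex; apply/eqP.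
have := idem_cubic x; rewrite !(ex, jmulZr, scalerA) -scalerDl.
move/eqP; rewrite -subr_eq0 -scalerBl scaler_eq0 => /orP[/eqP h|//].
by case/eqP: k0; rewrite -h; ring.
Qed.

(** The three Peirce projections: the Lagrange polynomials for the nodes 1, 1/2, 0, evaluated at
    L_e. *)
Definition comp1 x := 2 *: (e ∘ (e ∘ x)) - e ∘ x.
Definition comph x := 4 *: (e ∘ x - e ∘ (e ∘ x)).
Definition comp0 x := x - 3 *: (e ∘ x) + 2 *: (e ∘ (e ∘ x)).

Lemma peirce_comp1 x : peirce e 1 (comp1 x).
Proof. have := idem_cubic x; rewrite /comp1 /peirce => H; vec. Qed.
Lemma peirce_comph x : peirce e 2^-1 (comph x).
Proof. have := idem_cubic x; rewrite /comph /peirce => H; vec. Qed.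
Lemma peirce_comp0 x : peirce e 0 (comp0 x).
Proof. have := idem_cubic x; rewrite /comp0 /peirce => H; vec. Qed.

Lemma peirce_dec x : x = comp1 x + comph x + comp0 x.
Proof. rewrite /comp1 /comph /comp0; vec. Qed.

Lemma jU_idem x : jU mul e x = comp1 x.
Proof. by rewrite /jU /comp1 idem (jmulC (e ∘ x)). Qed.

Lemma comp1E x1 xh x0 : peirce e 1 x1 -> peirce e 2^-1 xh -> peirce e 0 x0 ->
  comp1 (x1 + xh + x0) = x1.
Proof.
move=> h1 hh h0; rewrite /comp1 !jmulDr h1 hh h0 !jmulZr h1 hh h0; vec.
Qed.

Lemma peirce_idem : peirce e 1 e.
Proof. by rewrite /peirce idem scale1r. Qed.

(** [jordan_comm] at e, e, x reduces to (1 - 2k)[L_e, L_x] = 0. *)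
Lemma peirce_opcomm k x : k != 2^-1 -> peirce e k x -> opcomm e x.
Proof.
move=> k2 ex y; apply/eqP; rewrite -subr_eq0.
have := jordan_comm e e x y; rewrite idem (jmulC x e) ex !jmulZl !jmulZr => H.
have {H}: (1 - 2 * k) *: (e ∘ (x ∘ y) - x ∘ (e ∘ y)) = 0 by vec.
move/eqP; rewrite scaler_eq0 => /orP[/eqP h|//].
by case/eqP: k2; lra.
Qed.

Lemma peirce_mul k l x y : k != 2^-1 ->
  peirce e k x -> peirce e l y -> peirce e l (x ∘ y).
Proof.
by move=> k2 hx hy; rewrite /peirce (peirce_opcomm k2 hx) hy jmulZr.
Qed.

Lemma peirce10 x y : peirce e 1 x -> peirce e 0 y -> x ∘ y = 0.
Proof.
move=> hx hy; apply: (@peirce_uniq e 0 1) => //.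
- by rewrite eq_sym oner_neq0.
- by apply: peirce_mul hx hy; apply/eqP; lra.
by rewrite jmulC; apply: peirce_mul hy hx; apply/eqP; lra.
Qed.

(** This excludes an A_1/2-component of x ∘ y. Later [e ∘ (v ∘ v)] and its complement serve as the
    A_1- and A_0-parts of [v ∘ v]. *)
Lemma peirce_halfM x y : peirce e 2^-1 x -> peirce e 2^-1 y ->
  peirce e 1 (e ∘ (x ∘ y)).
Proof.
move=> hx hy; have := jordan_lin e e x y.
rewrite !(jmulC _ e) idem hx hy !jmulE !(jmulC _ e) hx hy !jmulE.
rewrite (jmulC y x) => H.
rewrite /peirce; vec.
Qed.

End Peirce.


Lemma opcommC x y : opcomm x y -> opcomm y x.
Proof. by move=> h z; rewrite h. Qed.

Lemma opcomm_sq a : opcomm a (a ∘ a).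
Proof. move=> z; have := jordan_comm a a a z => H; vec. Qed.

Lemma opcommD x y z : opcomm x y -> opcomm x z -> opcomm x (y + z).
Proof. by move=> h1 h2 w; rewrite !jmulDl jmulDr h1 h2. Qed.

Lemma opcommZ x k y : opcomm x y -> opcomm x (k *: y).
Proof. by move=> h w; rewrite !jmulZl jmulZr h. Qed.

(** * Polynomial calculus and power associativity *)

Section Eval.
Variables e a : A.
Hypotheses (idem : jidempotent mul e) (ea : e ∘ a = a).

(** Since e acts as a unit on a, it is the power of exponent 0; constant polynomials then evaluate
    to multiples of e. *)
Definition pow n := iter n (mul a) e.

Let a1 : peirce e 1 a. Proof. by rewrite /peirce scale1r. Qed.
Let neq1h : (1 : R) != 2^-1. Proof. by apply/eqP; lra. Qed.
Let opcomm_ea : opcomm e a. Proof. exact: peirce_opcomm neq1h a1. Qed.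

Lemma pow1 : pow 1 = a. Proof. by rewrite /pow /= jmulC. Qed.

Lemma pow2 : pow 2 = a ∘ a. Proof. by rewrite /pow /= (jmulC a e) ea. Qed.

(** This is [jordan_op] with b = a and c = a^n. By induction, whatever commutes with L_e, L_a and
    L_(a ∘ a) commutes with every L_(a^n). *)
Lemma pow_op n z : pow n.+2 ∘ z =
  2 *: (pow n.+1 ∘ (a ∘ z)) + pow 2 ∘ (pow n ∘ z)
  - (a ∘ (a ∘ (pow n ∘ z)) + pow n ∘ (a ∘ (a ∘ z))).
Proof.
have := jordan_op a a (pow n) z.
rewrite (jmulC (a ∘ pow n) a) (jmulC (pow n) a) -/(pow n.+1) -/(pow n.+2) pow2.
by move=> H; vec.
Qed.

Lemma opcomm_pow x n : opcomm x e -> opcomm x a -> opcomm x (a ∘ a) ->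
  opcomm x (pow n).
Proof.
move=> he ha h2; suff: opcomm x (pow n) /\ opcomm x (pow n.+1) by case.
elim: n => [|n [h1 h3]]; first by rewrite pow1.
split=> // z; rewrite !(pow_op n) pow2.
by rewrite !(jmulDr, jmulNr, jmulZr) !(h1, h2, h3, ha).
Qed.

Definition ev (p : {poly R}) := \sum_(i < size p) p`_i *: pow i.

Lemma ev_widen n (p : {poly R}) : (size p <= n)%N ->
  ev p = \sum_(i < n) p`_i *: pow i.
Proof.
move=> h; rewrite /ev (big_ord_widen _ (fun i => p`_i *: pow i) h).
rewrite big_mkcond; apply: eq_bigr => i _; case: ifP => // /negbT.
by rewrite -leqNgt => hi; rewrite nth_default ?scale0r.
Qed.

Lemma evD p q : ev (p + q) = ev p + ev q.
Proof.
set n := maxn (size p) (size q).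
rewrite (@ev_widen n) ?(@ev_widen n p) ?(@ev_widen n q) ?leq_maxl ?leq_maxr //.
  by rewrite -big_split; apply: eq_bigr => i _; rewrite coefD scalerDl.
exact: size_polyD.
Qed.

Lemma evZ k p : ev (k *: p) = k *: ev p.
Proof.
rewrite (@ev_widen (size p)) ?size_scale_leq // scaler_sumr.
by apply: eq_bigr => i _; rewrite coefZ scalerA.
Qed.

Lemma evC k : ev k%:P = k *: e.
Proof.
rewrite (@ev_widen 1) ?size_polyC_leq1 // big_ord1 coefC /=.
by [].
Qed.

Lemma ev0 : ev 0 = 0.
Proof. by rewrite -[0 in LHS]polyC0 evC scale0r. Qed.

Lemma ev1 : ev 1 = e.
Proof. by rewrite -[1 in LHS]polyC1 evC scale1r. Qed.

Lemma evN p : ev (- p) = - ev p.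
Proof. by rewrite -[- p]scaleN1r evZ scaleN1r. Qed.

Lemma evB p q : ev (p - q) = ev p - ev q.
Proof. by rewrite evD evN. Qed.

Lemma evMX p : ev (p * 'X) = a ∘ ev p.
Proof.
rewrite (@ev_widen (size p).+1); last first.
  by apply: leq_trans (size_polyMleq _ _) _; rewrite size_polyX addn2.
rewrite big_ord_recl coefMX /= scale0r add0r.
rewrite linear_sumr; apply: eq_bigr => i _.
by rewrite coefMX /= jmulZr.
Qed.

Lemma evX : ev 'X = a.
Proof. by rewrite -[X in ev X]mul1r evMX ev1 jmulC. Qed.

Lemma opcomm_ev x p : opcomm x e -> opcomm x a -> opcomm x (a ∘ a) ->
  opcomm x (ev p).
Proof.
move=> he ha h2; rewrite /ev; elim/big_rec: _ => [z|i y _ hy].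
  by rewrite !jmul0l jmul0r.
by apply: opcommD => //; apply: opcommZ; apply: opcomm_pow.
Qed.

Lemma opcomm_e_ev p : opcomm e (ev p).
Proof.
apply: opcomm_ev; [by [] | exact: opcomm_ea | ].
exact: peirce_opcomm neq1h (peirce_mul idem neq1h a1 a1).
Qed.

Lemma opcomm_a_ev p : opcomm a (ev p).
Proof.
apply: opcomm_ev; [exact: opcommC opcomm_ea | by [] | exact: opcomm_sq].
Qed.

Lemma opcomm_evs p q : opcomm (ev p) (ev q).
Proof.
apply: opcomm_ev; [exact: opcommC (opcomm_e_ev p) | | ].
  exact: opcommC (opcomm_a_ev p).
apply: opcommC; apply: opcomm_ev; [|exact: opcommC (@opcomm_sq a)|by []].
apply: opcommC; exact: peirce_opcomm neq1h (peirce_mul idem neq1h a1 a1).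
Qed.

Lemma ev_e p : e ∘ ev p = ev p.
Proof.
elim/poly_ind: p => [|p c IHp]; first by rewrite ev0 jmul0r.
by rewrite evD evMX evC jmulDr opcomm_ea IHp jmulZr idem.
Qed.

(** Power associativity: by [opcomm_a_ev] a factor a can be pulled out of the product, so induction
    on p applies. *)
Lemma evM p q : ev (p * q) = ev p ∘ ev q.
Proof.
elim/poly_ind: p => [|p c IHp]; first by rewrite mul0r ev0 jmul0l.
rewrite mulrDl mulrAC evD evMX IHp mul_polyC evZ evD evMX evC jmulDl jmulZl ev_e.
by rewrite (jmulC _ (ev q)) opcomm_a_ev (jmulC (ev q)).
Qed.

End Eval.


(** * Subalgebras, minimal polynomials and support idempotents *)

Definition subalg (V : A -> Prop) :=
  [/\ V 0, forall x y, V x -> V y -> V (x + y),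
      forall k x, V x -> V (k *: x) & forall x y, V x -> V y -> V (x ∘ y)].

Lemma subalg_peirce e k : jidempotent mul e -> k = 0 \/ k = 1 ->
  subalg (peirce e k).
Proof.
move=> idem k01; split; first by rewrite /peirce jmul0r scaler0.
- exact: peirceD.
- by move=> l x; apply: peirceZ.
by move=> x y; apply: peirce_mul => //; apply/eqP; lra.
Qed.

Lemma subalg_ev e a V : subalg V -> V a -> e ∘ a = a ->
  forall r, V (ev e a (r * 'X)).
Proof.
move=> [V0 VD VZ VM] Va ea; elim/poly_ind => [|r c IHr].
  by rewrite mul0r ev0.
rewrite mulrDl evD evMX mul_polyC evZ evX //.
by apply: VD; [apply: VM | apply: VZ].
Qed.

Lemma root0_mulX (p : {poly R}) : p`_0 = 0 -> exists q, p = q * 'X.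
Proof.
move=> p0; have /factor_theorem [q ->] : root p 0.
  by rewrite /root horner_coef0 p0.
by exists q; rewrite subr0.
Qed.

(** The minimal polynomial of a relative to e; it exists because dim A + 1 powers are linearly
    dependent. *)
Lemma annihilator e a : exists m : {poly R}, [/\ m != 0, ev e a m = 0 &
  forall p : {poly R}, p != 0 -> ev e a p = 0 -> (size m <= size p)%N].
Proof.
have [p p0 ep] : exists2 p, p != 0 & ev e a p = 0.
  apply: contrapT => H.
  pose n := (\dim (fullv : {vspace A})).+1.
  pose X := [tuple pow e a i | i < n].
  have : free X.
    apply/freeP => k hk i.
    pose p := \poly_(i < n) k (inord i).
    have ep : ev e a p = 0.
      rewrite (@ev_widen _ _ n) ?size_poly // -[RHS]hk.
      apply: eq_bigr => j _.
      by rewrite coef_poly ltn_ord inord_val (nth_map j) ?size_enum_ord //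
        -tnth_nth tnth_ord_tuple.
    have /eqP p0 : p == 0 by apply: contra_notT H => p0; exists p.
    have := congr1 (fun p : {poly R} => p`_i) p0.
    by rewrite coef0 coef_poly ltn_ord inord_val.
  rewrite /free size_tuple => /eqP h.
  by have := dimvS (subvf <<X>>); rewrite h ltnn.
have ex : exists n,
    `[< exists m : {poly R}, [/\ m != 0, ev e a m = 0 & size m = n] >].
  by exists (size p); apply/asboolP; exists p.
case: (ex_minnP ex) => n /asboolP [m [m0 em <-]] mmin; exists m; split=> //.
by move=> q q0 eq; apply: mmin; apply/asboolP; exists q.
Qed.

Hypothesis nilfree : forall x, x ∘ x = 0 -> x = 0.

(** The minimal polynomial m is not divisible by X^2: if m = m1 X and m1 = m2 X, then m1^2 = m2 m
    kills a, so m1(a) has square 0 and m1 contradicts minimality. *)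
Lemma annihilator_X e a : jidempotent mul e -> e ∘ a = a ->
  exists2 q : {poly R}, q`_0 = 1 & ev e a (q * 'X) = 0.
Proof.
move=> idem ea; have [m [m0 em mmin]] := annihilator e a.
suff [q q0 eq] : exists2 q : {poly R}, q`_0 != 0 & ev e a (q * 'X) = 0.
  exists ((q`_0)^-1 *: q); first by rewrite coefZ mulVf.
  by rewrite -scalerAl evZ eq scaler0.
have [mc0|] := eqVneq m`_0 0; last first.
  by exists m => //; rewrite evMX em jmul0r.
have [m1 dm] := root0_mulX mc0; exists m1; last by rewrite -dm.
apply/eqP => m1c; have [m2 dm1] := root0_mulX m1c.
have m10 : m1 != 0 by apply: contraNneq m0 => z; rewrite dm z mul0r.
have : ev e a m1 = 0.
  apply: nilfree; rewrite -evM // {2}dm1 mulrA mulrAC -dm evM // em.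
  by rewrite jmul0l.
by move/(mmin _ m10); rewrite dm size_mulX // ltnn.
Qed.

Variable u : A.
Hypothesis unit_u : forall x, u ∘ x = x.

(** With b = a^2 and qX annihilating b, q(0) = 1, take s = (1 - q)(b). Building s from a^2 lets
    Peirce information about a^2 alone pass to s. *)
Lemma support a : exists s, [/\ jidempotent mul s, s ∘ a = a &
  forall V, subalg V -> V (a ∘ a) -> V s].
Proof.
set b := a ∘ a; have uu : jidempotent mul u by exact: unit_u.
have [q q0 eq] := annihilator_X uu (unit_u b).
have [|r dr] := @root0_mulX (1 - q); first by rewrite coefB coef1 q0 subrr.
set s := ev u b (r * 'X).
have Vs V : subalg V -> V b -> V s.
  by move=> hV Vb; apply: subalg_ev.
have sb : s ∘ b = b.
  rewrite -{1}(evX (unit_u b)) -evM // -dr mulrBl mul1r evB eq subr0.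
  exact: evX.
exists s; split=> //.
  rewrite /jidempotent -evM // -{1}dr mulrBl mul1r evB mulrCA.
  rewrite (evM _ _ r (q * 'X)) // eq.
  by rewrite jmul0r subr0.
have [t ds] : exists t, s = ev u a t.
  apply: (Vs (fun x => exists t, x = ev u a t)); last first.
    by exists ('X * 'X); rewrite evM // evX.
  split; first by exists 0; rewrite ev0.
  - by move=> x y [p ->] [p' ->]; exists (p + p'); rewrite evD.
  - by move=> k x [p ->]; exists (k *: p); rewrite evZ.
  by move=> x y [p ->] [p' ->]; exists (p * p'); rewrite evM.
(* As s is a polynomial in a, (a - s a)^2 = (a^2 - s a^2)(u - s), and s a^2 = a^2. *)
apply/esym/eqP; rewrite -subr_eq0; apply/eqP/nilfree.
have -> : a - s ∘ a = ev u a ('X - t * 'X).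
  by rewrite evB evM // evX // -ds.
rewrite -evM //.
have -> : ('X - t * 'X) * ('X - t * 'X) = ('X * 'X - t * ('X * 'X)) * (1 - t).
  by ring.
rewrite evM // evB (evM _ _ t ('X * 'X)) // (evM _ _ 'X 'X) // evX //.
rewrite -ds -/b sb subrr.
exact: jmul0l.
Qed.


(** * Maximal idempotents and units of subalgebras *)

Let half_neq1 : (1 : R) != 2^-1. Proof. by apply/eqP; lra. Qed.
Let half_neq0 : (0 : R) != 2^-1. Proof. by apply/eqP; lra. Qed.

Lemma peirceB e k x y : peirce e k x -> peirce e k y -> peirce e k (x - y).
Proof. by move=> hx hy; apply: peirceD => //; apply: peirceN. Qed.

Lemma idem_add e s : jidempotent mul e -> jidempotent mul s -> e ∘ s = 0 ->
  jidempotent mul (e + s).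
Proof.
by rewrite /jidempotent !jmulE => -> -> h; rewrite (jmulC s) h add0r addr0.
Qed.

Lemma idem_sub e s : jidempotent mul e -> jidempotent mul s -> e ∘ s = s ->
  jidempotent mul (e - s).
Proof.
rewrite /jidempotent !jmulE => -> -> h; rewrite (jmulC s) h; vec.
Qed.

(** The support s of v lies in A_0(e), so e + s is an idempotent with v as eigenvector for 1/2 + 1 =
    3/2, which is impossible unless v = 0. *)
Lemma peirce_half_sq0 e v : jidempotent mul e -> peirce e 2^-1 v ->
  peirce e 0 (v ∘ v) -> v = 0.
Proof.
move=> idem hv hvv; have [s [ss sv sV]] := support v.
have es : peirce e 0 s by apply: sV hvv; apply: subalg_peirce => //; left.
have {}es : e ∘ s = 0 by rewrite es scale0r.
have ess : jidempotent mul (e + s) by exact: idem_add.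
apply: (@peirce_eigen _ ess (3 / 2)); first by apply/eqP; lra.
by rewrite /peirce jmulDl hv sv; vec.
Qed.

(** A_1(e) as a subspace, so that its dimension can measure the size of e. *)
Definition eigen1 e := lker (linfun (mul e) - \1)%VF.

Lemma eigen1P e x : reflect (e ∘ x = x) (x \in eigen1 e).
Proof.
rewrite memv_ker !lfun_simp subr_eq0; exact: eqP.
Qed.

Lemma eigen1_dim_lt e s : jidempotent mul e -> jidempotent mul s -> s != 0 ->
  e ∘ s = 0 -> (\dim (eigen1 e) < \dim (eigen1 (e + s)))%N.
Proof.
move=> idem ss s0 es; rewrite ltn_neqAle.
have p0 : peirce e 0 s by rewrite /peirce es scale0r.
have sub : (eigen1 e <= eigen1 (e + s))%VS.
  apply/subvP => x /eigen1P ex; apply/eigen1P; rewrite jmulDl ex (jmulC s).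
  by rewrite (peirce10 idem _ p0) ?addr0 // /peirce scale1r.
rewrite dimvS // andbT; apply: contra s0 => /eqP dimE.
have E : eigen1 e = eigen1 (e + s) by apply/eqP; rewrite eqEdim sub dimE /=.
have : s \in eigen1 (e + s) by apply/eigen1P; rewrite jmulDl es ss add0r.
by rewrite -E => /eigen1P; rewrite es => ->.
Qed.

Lemma comp_subalg V e x : subalg V -> V e -> V x ->
  [/\ V (comp1 e x), V (comph e x) & V (comp0 e x)].
Proof.
move=> [V0 VD VZ VM] Ve Vx.
have VB y z : V y -> V z -> V (y - z).
  by move=> Vy Vz; apply: VD => //; rewrite -scaleN1r; apply: VZ.
have Vex : V (e ∘ x) by apply: VM.
have Veex : V (e ∘ (e ∘ x)) by apply: VM.
by split; [apply: VB | apply: VZ; apply: VB | apply: VD; first apply: VB];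
  try apply: VZ.
Qed.

(** The unit is an idempotent e of V with dim A_1(e) maximal; the A_0(e)- and A_1/2(e)-components of
    elements of V have to vanish. *)
Lemma subalg_unit V : subalg V ->
  exists e, [/\ jidempotent mul e, V e & forall x, V x -> e ∘ x = x].
Proof.
move=> hV; have [V0 VD VZ VM] := hV.
pose P n := `[< exists e, [/\ jidempotent mul e, V e & \dim (eigen1 e) = n] >].
have exP : exists n, P n.
  by exists (\dim (eigen1 0)); apply/asboolP; exists 0; split=> //; apply: jmul0l.
have ubP n : P n -> (n <= \dim (fullv : {vspace A}))%N.
  by move/asboolP => [e [_ _ <-]]; apply: dimvS; apply: subvf.
case: (ex_maxnP exP ubP) => n /asboolP [e [idem Ve <-]] emax.
(* The support of a nonzero element of V in A_0(e) could be added to e, against maximality. *)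
have V_0 x : V x -> peirce e 0 x -> x = 0.
  move=> Vx hx; have [s [ss sx sV]] := support x.
  have Vs : V s by apply: sV => //; apply: VM.
  have es : e ∘ s = 0.
    have := sV _ (subalg_peirce idem (or_introl erefl))
      (peirce_mul idem half_neq0 hx hx).
    by rewrite /peirce scale0r.
  have [s0|s0] := eqVneq s 0; first by rewrite -sx s0 jmul0l.
  have := eigen1_dim_lt idem ss s0 es; rewrite ltnNge => /negP []; apply: emax.
  by apply/asboolP; exists (e + s); split=> //; [apply: idem_add | apply: VD].
exists e; split=> // x Vx; have [V1 Vh V0'] := comp_subalg hV Ve Vx.
have x0 := V_0 _ V0' (peirce_comp0 idem x).
suff xh : comph e x = 0.
  rewrite {2}(peirce_dec idem x) xh x0 !addr0 {1}(peirce_dec idem x) xh x0 !addr0.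
  by rewrite (peirce_comp1 idem) scale1r.
set v := comph e x in Vh *; have hv : peirce e 2^-1 v := peirce_comph idem x.
have Vw : V (v ∘ v) by apply: VM.
have ew := peirce_halfM idem hv hv.
have w0 : v ∘ v - e ∘ (v ∘ v) = 0.
  apply: V_0; last first.
    by move: ew; rewrite /peirce jmulDr jmulNr scale1r => ->; rewrite subrr scale0r.
  by rewrite -scaleN1r; apply: VD => //; apply: VZ; apply: VM.
have w1 : peirce e 1 (v ∘ v) by move/subr0_eq: w0 => {1}->.
have [s [ss sv sV]] := support v.
have es : e ∘ s = s.
  have := sV _ (subalg_peirce idem (or_intror erefl)) w1.
  by rewrite /peirce scale1r.
(* Here s is in A_1(e) and s v = v, so e - s has eigenvalue 1/2 - 1 = -1/2 on v. *)
have ess := idem_sub idem ss es.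
apply: (@peirce_eigen _ ess (- 2^-1)); first by apply/eqP; lra.
by rewrite /peirce jmulDl jmulNl hv sv; vec.
Qed.

(* With w = v ∘ v, the square of r(w)v is w r(w)^2; here r = c + d'X. *)
Lemma peirce_half_cubic e v p q c d : jidempotent mul e ->
  peirce e 2^-1 v -> v ∘ v = p + q -> peirce e 1 p -> peirce e 0 q ->
  let b := c *: v + d *: (v ∘ (v ∘ v)) in
  peirce e 2^-1 b /\ exists2 q', peirce e 0 q' &
    b ∘ b = c ^+ 2 *: p + (2 * c * d) *: (p ∘ p) + d ^+ 2 *: (p ∘ (p ∘ p)) + q'.
Proof.
move=> idem hv vv hp hq b; split.
  apply: peirceD; apply: peirceZ => //; rewrite vv jmulC jmulDl.
  by apply: peirceD;
    [apply: (peirce_mul idem half_neq1) | apply: (peirce_mul idem half_neq0)].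
have pp := peirce_mul idem half_neq1 hp hp.
have qq := peirce_mul idem half_neq0 hq hq.
have qqq := peirce_mul idem half_neq0 hq qq.
exists (c ^+ 2 *: q + (2 * c * d) *: (q ∘ q) + d ^+ 2 *: (q ∘ (q ∘ q))).
  by apply: peirceD; [apply: peirceD|]; apply: peirceZ.
have bb : b ∘ b = c ^+ 2 *: (v ∘ v) + (2 * c * d) *: ((v ∘ v) ∘ (v ∘ v))
    + d ^+ 2 *: ((v ∘ v) ∘ ((v ∘ v) ∘ (v ∘ v))).
  pose E := ev u v; have uu : jidempotent mul u by exact: unit_u.
  have EX : E 'X = v by exact: evX.
  have EM x y : E (x * y) = E x ∘ E y by exact: evM.
  rewrite /b -EX -!EM -!evZ -!evD -!EM; congr (ev _ _ _).
  by rewrite -!mul_polyC !polyCM; ring.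
have pq : p ∘ q = 0 by exact: (peirce10 idem).
have pqq : p ∘ (q ∘ q) = 0.
  exact: (peirce10 idem).
have qpp : q ∘ (p ∘ p) = 0.
  by rewrite jmulC; apply: (peirce10 idem).
rewrite bb vv !jmulE (jmulC q p) pq !jmulE pqq qpp; vec.
Qed.


(** * Negative squares in A_1/2 *)

Lemma peirce_half_neg e v k q : jidempotent mul e -> e != 0 ->
  peirce e 2^-1 v -> peirce e 0 q -> v ∘ v = k *: e + q -> ~ k < 0.
Proof.
move=> idem e0 hv hq vv k0; pose t := Num.sqrt (- k)^-1.
have tk : t ^+ 2 * k = -1.
  rewrite sqr_sqrtr ?invr_ge0 ?oppr_ge0 ?ltW // invrN mulNr mulVf //.
  exact: ltr0_neq0.
pose x := t *: v; pose r := t ^+ 2 *: q.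
have hx : peirce e 2^-1 x by apply: peirceZ.
have hr : peirce e 0 r by apply: peirceZ.
have xx : x ∘ x = - e + r.
  by rewrite jmulZl jmulZr vv scalerA scalerDr scalerA -expr2 tk scaleN1r.
clearbody x r.
have hNe : peirce e 1 (- e) by apply: peirceN; apply: peirce_idem.
(* For b = x + x^3 the A_1-part of b^2 is -e + 2e - e = 0, hence b = 0. *)
have xw : x ∘ (x ∘ x) = - x.
  have [hb [q' hq' bb]] := peirce_half_cubic 1 1 idem hx xx hNe hr.
  have : 1 *: x + 1 *: (x ∘ (x ∘ x)) = 0.
    apply: (peirce_half_sq0 idem hb); rewrite bb !jmulE !idem.
    by rewrite (_ : _ + q' = q') //; vec.
  by rewrite !scale1r => /eqP; rewrite addrC addr_eq0 => /eqP.
have xr : x ∘ r = - (2^-1 *: x).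
  by move: xw; rewrite xx jmulDr jmulNr (jmulC x e) hx => H; vec.
have rr : r ∘ r = - r.
  have : (x ∘ x) ∘ (x ∘ x) = x ∘ (x ∘ (x ∘ x)).
    have EX : ev u x 'X = x by exact: evX.
    by rewrite -EX -!evM //; congr (ev _ _ _); ring.
  have er : e ∘ r = 0 by rewrite hr scale0r.
  rewrite xw jmulNr xx !jmulE idem (jmulC r e) er => H; vec.
have ex : e ∘ x = 2^-1 *: x by [].
have er : e ∘ r = 0 by rewrite hr scale0r.
(* The element of square 0; applying e once and twice then gives e + x/2 = 0 and e + x/4 = 0, so e =
   0. *)
have : e + r + x = 0.
  apply: nilfree; rewrite !jmulE idem rr xx (jmulC r e) (jmulC x e) (jmulC r x).
  by rewrite er ex xr; vec.
move/(congr1 (mul e)); rewrite !jmulE idem er ex => H.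
have := congr1 (mul e) H; rewrite !jmulE idem ex => H'.
case/eqP: e0; clear -H H'; vec.
Qed.

(** * Primitive idempotents and the spectrum of elements of A_1(e) *)

Definition primitive e := [/\ e != 0, jidempotent mul e &
  forall s, jidempotent mul s -> e ∘ s = s -> s = 0 \/ s = e].

Section Primitive.
Variable e : A.
Hypothesis prim : primitive e.

Let e0 : e != 0. Proof. by case: prim. Qed.
Let idem : jidempotent mul e. Proof. by case: prim. Qed.

(** The values r(a) with (rq)(a) = 0 contain p(a)^2, hence the support s of p(a). Primitivity leaves
    s = 0, so p(a) = 0, or s = e, so q(a) = 0. *)
Lemma primitive_integral a p q : e ∘ a = a -> ev e a (p * q) = 0 ->
  ev e a p = 0 \/ ev e a q = 0.
Proof.
move=> ea pq; have [s [ss sp sV]] := support (ev e a p).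
have [r ds rq] : exists2 r, s = ev e a r & ev e a (r * q) = 0.
  apply: (sV (fun x => exists2 r, x = ev e a r & ev e a (r * q) = 0)).
    split; first by exists 0; rewrite ?mul0r ev0.
    - move=> x y [r -> hr] [r' -> hr']; exists (r + r'); first by rewrite evD.
      by rewrite mulrDl evD hr hr' addr0.
    - move=> k x [r -> hr]; exists (k *: r); first by rewrite evZ.
      by rewrite -scalerAl evZ hr scaler0.
    move=> x y [r -> hr] [r' -> hr']; exists (r * r'); first by rewrite evM.
    by rewrite -mulrA evM // hr' jmul0r.
  by exists (p * p); [rewrite evM | rewrite -mulrA evM // pq jmul0r].
case: prim => _ _ /(_ s ss) [|s0|se]; first by rewrite ds ev_e.
  by left; rewrite -sp s0 jmul0l.
by right; rewrite -(ev_e idem ea q) -[X in X ∘ _]se ds -evM.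
Qed.

(** Take z a complex root of the minimal polynomial m. If P vanishes at z, then d = gcd(P, m) is not
    constant, so (m / d)(a) is nonzero by minimality and integrality forces d(a) = 0. *)
Lemma primitive_spectrum a : e ∘ a = a -> exists z : R[i],
  forall P : {poly R}, root (map_poly (real_complex R) P) z -> ev e a P = 0.
Proof.
move=> ea; have [m [m0 em mmin]] := annihilator e a.
have sm : size (map_poly (real_complex R) m) != 1.
  rewrite size_map_poly; apply/eqP => /eqP/size_poly1P [c c0 dm].
  move/eqP: em; rewrite dm evC scaler_eq0 (negPf e0) orbF; exact/negP.
have /closed_rootP [z mz] := sm; exists z => P Pz.
pose d := gcdp P m.
have dz : root (map_poly (real_complex R) d) z.
  by rewrite gcdp_map root_gcd Pz mz.
have dm : m = m %/ d * d by rewrite divpK ?dvdp_gcdr.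
have dP : P = P %/ d * d by rewrite divpK ?dvdp_gcdl.
have md0 : m %/ d != 0 by apply: contraNneq m0 => h; rewrite dm h mul0r.
have d0 : d != 0 by apply: contraNneq m0 => h; rewrite dm h mulr0.
have sd : (1 < size d)%N.
  rewrite -(size_map_poly (real_complex R)); apply: root_size_gt1 dz.
  by rewrite map_poly_eq0.
rewrite dP evM //.
have [||->] := @primitive_integral a (m %/ d) d ea; last 1 first.
- by rewrite jmul0r.
- by rewrite -dm.
move/(mmin _ md0); rewrite size_divp // leqNgt => /negP [].
by rewrite ltn_subrL -subn1 subn_gt0 sd size_poly_gt0.
Qed.


Lemma primitive_alt a : e ∘ a = a -> (exists k, a = k *: e) \/
  exists2 z : R[i], complex.Im z != 0 & forall P : {poly R},
    root (map_poly (real_complex R) P) z -> ev e a P = 0.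
Proof.
move=> ea; have [z hz] := primitive_spectrum ea.
have [zr|] := eqVneq (complex.Im z) 0; last by right; exists z.
left; exists (complex.Re z); apply/eqP; rewrite -subr_eq0.
rewrite -{1}(evX ea) -(evC e a) -evB.
apply/eqP/hz; rewrite rmorphB /= map_polyX map_polyC /root !hornerE subr_eq0.
by rewrite eq_complex /= zr !eqxx.
Qed.

End Primitive.

(** * Elements with a non-real spectral value *)

Lemma complex_interpol (z t : R[i]) : complex.Im z != 0 ->
  exists c d : R, c%:C%C + d%:C%C * z = t.
Proof.
case: z t => [x y] [x' y'] /= y0; exists (x' - y' / y * x), (y' / y).
by apply/eqP; rewrite eq_complex /=; apply/andP; split; apply/eqP; field.
Qed.

Section ComplexSpectrum.
Variables (e a : A) (z : R[i]).
Hypotheses (idem : jidempotent mul e) (ea : e ∘ a = a).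
Hypotheses (imz : complex.Im z != 0) (hz : forall P : {poly R},
    root (map_poly (real_complex R) P) z -> ev e a P = 0).

Lemma sqrt_neg_exists : exists2 j, e ∘ j = j & j ∘ j = - e.
Proof.
(* The polynomial c + dX takes the value i at z, so its square plus 1 vanishes there. *)
have [c [d cd]] := complex_interpol 'i%C imz.
exists (ev e a (c%:P + d%:P * 'X)); first exact: ev_e.
apply/eqP; rewrite -addr_eq0 -evM // -[X in _ + X](ev1 e a) -evD; apply/eqP/hz.
rewrite /root !(rmorphD, rmorphM, rmorph1) /= map_polyX !map_polyC !hornerE.
by rewrite /= cd -expr2 sqr_i addNr.
Qed.

(** The left-hand side is the A_1-part of b^2 in [peirce_half_cubic] for p = a. It is a(c + da)^2,
    and c + dz can be made a square root of -1/z. *)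
Lemma cubic_neg_exists : exists c d : R,
  c ^+ 2 *: a + (2 * c * d) *: (a ∘ a) + d ^+ 2 *: (a ∘ (a ∘ a)) = - e.
Proof.
have z0 : z != 0 by apply: contraNneq imz => ->.
have [c [d cd]] := complex_interpol (sqrtc (- z^-1)) imz.
exists c, d; pose P : {poly R} := 'X * (c%:P + d%:P * 'X) ^+ 2 + 1.
have : ev e a P = 0.
  apply: hz.
  rewrite /root !(rmorphD, rmorphM, rmorph1, rmorphXn) /= map_polyX !map_polyC.
  by rewrite !hornerE /= cd -mulrA -expr2 sqr_sqrtc mulrN mulfV // addNr.
have -> : P = c ^+ 2 *: 'X + (2 * c * d) *: ('X * 'X) +
    d ^+ 2 *: ('X * ('X * 'X)) + 1.
  by rewrite /P -!mul_polyC !polyCM; ring.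
rewrite !evD !evZ !evM // !evX // ev1 => /eqP.
by rewrite addr_eq0 => /eqP.
Qed.

End ComplexSpectrum.

(** * Rigidity of A_1(e) when A_1/2(e) is nonzero *)

Lemma peirce_half_nonpos e v k q : jidempotent mul e -> e != 0 ->
  peirce e 2^-1 v -> peirce e 0 q -> v ∘ v = k *: e + q -> k <= 0 -> v = 0.
Proof.
move=> idem e0 hv hq vv; rewrite le_eqVlt => /orP[/eqP k0|]; last first.
  by move/(peirce_half_neg idem e0 hv hq vv).
by apply: (peirce_half_sq0 idem hv); rewrite vv k0 scale0r add0r.
Qed.

(** On v, j acts like i/2; passing from v to j v therefore changes the sign of k. *)
Lemma peirce_half_twist e j v k q : jidempotent mul e -> e ∘ j = j ->
  j ∘ j = - e -> peirce e 2^-1 v -> v ∘ v = k *: e + q -> peirce e 0 q ->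
  [/\ peirce e 2^-1 (j ∘ v), j ∘ (j ∘ v) = - (4^-1 *: v) &
      (j ∘ v) ∘ (j ∘ v) = - (k / 4) *: e - 4^-1 *: q].
Proof.
move=> idem ej jj hv vv hq.
have hj : peirce e 1 j by rewrite /peirce scale1r.
have hw : peirce e 2^-1 (j ∘ v) by exact: (peirce_mul idem half_neq1).
have ev : e ∘ v = 2^-1 *: v by [].
have ew : e ∘ (j ∘ v) = 2^-1 *: (j ∘ v) by [].
have jq : j ∘ q = 0 by exact: (peirce10 idem).
have eq : e ∘ q = 0 by rewrite hq scale0r.
have jjv : j ∘ (j ∘ v) = - (4^-1 *: v).
  have hjw := peirce_mul idem half_neq1 hj hw.
  have ejw : e ∘ (j ∘ (j ∘ v)) = 2^-1 *: (j ∘ (j ∘ v)) by [].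
  have := jordan_op j j e v.
  rewrite (jmulC j e) ej jj !jmulE ev !jmulE ev => H.
  clear -H ejw; vec.
split=> //; have := jordan_lin j j v v.
rewrite (jmulC v j) (jmulC (j ∘ v) j) jjv vv jj !jmulE ej (jmulC q j) jq.
rewrite !jmulE (jmulC q e) eq jj idem vv => H.
clear -H; vec.
Qed.

(** A nonscalar element of A_1(e) yields j with j^2 = -e. Then v, j v or some c v + d v^3 has a
    square whose A_1-part is a nonpositive multiple of e, which is excluded. *)
Lemma primitive_scalar e v a : primitive e -> peirce e 2^-1 v -> v != 0 ->
  e ∘ a = a -> exists k, a = k *: e.
Proof.
move=> prim hv v0 ea; have [e0 idem _] := prim.
case: (primitive_alt prim ea) => // -[z imz hz]; exfalso.
have [j ej jj] := sqrt_neg_exists idem ea imz hz => {a ea z imz hz}.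
pose p := e ∘ (v ∘ v); pose q := v ∘ v - p.
have hp : peirce e 1 p := peirce_halfM idem hv hv.
have ep : e ∘ p = p by rewrite hp scale1r.
have hq : peirce e 0 q by rewrite /peirce jmulDr jmulNr ep subrr scale0r.
have vv : v ∘ v = p + q by rewrite addrC subrK.
clearbody p q; case: (primitive_alt prim ep) => [[k pk]|[z imz hz]].
  rewrite pk in vv; case: (lerP k 0) => k0.
    by move/eqP: v0; apply; apply: peirce_half_nonpos vv k0.
  have [hw jw ww] := peirce_half_twist idem ej jj hv vv hq.
  apply: (peirce_half_neg idem e0 hw _ ww); last by lra.
  by rewrite -scaleNr; apply: peirceZ.
have [c [d cd]] := cubic_neg_exists idem ep imz hz.
have [hb [q' hq' bb]] := peirce_half_cubic c d idem hv vv hp hq.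
rewrite cd -scaleN1r in bb.
by apply: (peirce_half_neg idem e0 hb hq' bb); lra.
Qed.

(** * From a vanishing A_1-part of y^2 to orthogonality to y *)

Lemma primitive_annihilates e y : primitive e -> comp1 e (y ∘ y) = 0 ->
  e ∘ y = 0.
Proof.
move=> prim y0; have [e0 idem _] := prim.
set y1 := comp1 e y; set v := comph e y; set z := comp0 e y.
have h1 : peirce e 1 y1 := peirce_comp1 idem y.
have hv : peirce e 2^-1 v := peirce_comph idem y.
have hz : peirce e 0 z := peirce_comp0 idem y.
have dy : y = y1 + v + z := peirce_dec idem y.
clearbody y1 v z; pose p := e ∘ (v ∘ v); pose q := v ∘ v - p.
have hp : peirce e 1 p := peirce_halfM idem hv hv.
have ep : e ∘ p = p by rewrite hp scale1r.
have hq : peirce e 0 q by rewrite /peirce jmulDr jmulNr ep subrr scale0r.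
have vv : v ∘ v = p + q by rewrite addrC subrK.
clearbody p q.
have y1p : y1 ∘ y1 + p = 0.
  rewrite -{}y0 dy.
  (* The three groups are the A_1-, A_1/2- and A_0-parts of y^2. *)
  have -> : (y1 + v + z) ∘ (y1 + v + z) =
      (y1 ∘ y1 + p) + 2 *: (y1 ∘ v + z ∘ v) + (q + z ∘ z).
    have y1z : y1 ∘ z = 0 by exact: (peirce10 idem).
    rewrite !jmulE (jmulC v y1) (jmulC v z) (jmulC z y1) y1z vv; vec.
  rewrite (comp1E idem) //.
    by apply: peirceD => //; apply: (peirce_mul idem half_neq1).
    apply: peirceZ; apply: peirceD; first exact: (peirce_mul idem half_neq1).
    exact: (peirce_mul idem half_neq0).
  by apply: peirceD => //; apply: (peirce_mul idem half_neq0).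
have e1 : e ∘ y1 = y1 by rewrite h1 scale1r.
suff v0 : v = 0.
  have pq : p = - q by apply/eqP; rewrite -addr_eq0 -vv v0 jmul0l.
  have p0 : p = 0 by rewrite -ep pq jmulNr hq scale0r oppr0.
  have y10 : y1 = 0 by apply: nilfree; rewrite -y1p p0 addr0.
  by rewrite dy y10 v0 !add0r hz scale0r.
apply: contrapT => /eqP v0; have [k yk] := primitive_scalar prim hv v0 e1.
have pk : p = - k ^+ 2 *: e.
  apply/eqP; rewrite scaleNr -addr_eq0 addrC -y1p yk !jmulE idem.
  by rewrite scalerA expr2.
rewrite pk in vv; case/eqP: v0; apply: (peirce_half_nonpos idem e0 hv hq vv).
by rewrite oppr_le0 sqr_ge0.
Qed.

(** The A_1(g)-component of x lies in A_1(f). It also lies in A_1/2(f), because g x = g x_h with x_h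
    the A_1/2(f)-component of x. *)
Lemma comp1_sub f g x : jidempotent mul f -> jidempotent mul g -> f ∘ g = g ->
  comp1 f x = 0 -> comp1 g x = 0.
Proof.
move=> ff gg fg x0.
have hg : peirce f 1 g by rewrite /peirce scale1r.
have h1 : peirce f 1 (comp1 g x).
  have gx : peirce g 1 (comp1 g x) := peirce_comp1 gg x.
  have hfg : peirce g 0 (f - g).
    by rewrite /peirce jmulDr jmulNr (jmulC g) fg gg subrr scale0r.
  have := peirce10 gg gx hfg; rewrite jmulC jmulDl jmulNl gx => /eqP.
  by rewrite subr_eq0 => /eqP.
apply: (peirce_uniq half_neq1 h1).
have gx : g ∘ x = g ∘ comph f x.
  rewrite {1}(peirce_dec ff x) x0 add0r jmulDr.
  by rewrite (peirce10 ff hg (peirce_comp0 ff x)) addr0.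
have hgx := peirce_mul ff half_neq1 hg (peirce_comph ff x).
rewrite /comp1 gx; apply: peirceB => //; apply: peirceZ.
exact: (peirce_mul ff half_neq1).
Qed.

(** Induction on dim A_1(f): a nonprimitive f splits into orthogonal idempotents g and f - g with
    smaller A_1-spaces, and [comp1_sub] passes the hypothesis to both. *)
Lemma idem_annihilates f y : jidempotent mul f -> comp1 f (y ∘ y) = 0 ->
  f ∘ y = 0.
Proof.
have [n] := ubnP (\dim (eigen1 f)); elim: n f => // n IHn f fn ff fy.
have [->|f0] := eqVneq f 0; first by rewrite jmul0l.
apply: contrapT => fy0.
suff : primitive f by move/primitive_annihilates/(_ fy).
split=> // g gg fg; apply: contrapT => /not_orP [/eqP g0 /eqP gf].
have hh := idem_sub ff gg fg.
have gh : g ∘ (f - g) = 0 by rewrite jmulDr jmulNr (jmulC g) fg gg subrr.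
have hg : (f - g) ∘ g = 0 by rewrite jmulC.
have h0 : f - g != 0 by rewrite subr_eq0 eq_sym.
have fh : f ∘ (f - g) = f - g by rewrite jmulDr jmulNr ff fg.
have dg := eigen1_dim_lt gg hh h0 gh; rewrite (addrC g) subrK in dg.
have dh := eigen1_dim_lt hh gg g0 hg; rewrite subrK in dh.
apply: fy0; rewrite -(subrK g f) jmulDl.
have -> : (f - g) ∘ y = 0.
  by apply: IHn => //; [apply: leq_trans dh _ | apply: comp1_sub fy].
have -> : g ∘ y = 0.
  by apply: IHn => //; [apply: leq_trans dg _ | apply: comp1_sub fy].
exact: addr0.
Qed.


(** * Inverses on the support and injectivity of U_a *)

Lemma support_inv a : exists s b, [/\ jidempotent mul s, s ∘ a = a, s ∘ b = b &
  [/\ a ∘ b = s, (a ∘ a) ∘ b = a, (b ∘ b) ∘ a = b &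
      opcomm b a /\ opcomm b (a ∘ a)]].
Proof.
have uu : jidempotent mul u by exact: unit_u.
have [s [ss sa sV]] := support a; pose E := ev u a.
have EX : E 'X = a by exact: evX.
have EM x y : E (x * y) = E x ∘ E y by exact: evM.
have [r ds] : exists r, s = E (r * 'X).
  apply: (sV (fun x => exists r, x = E (r * 'X))); last first.
    by exists 'X; rewrite EM EX.
  split; first by exists 0; rewrite /E mul0r ev0.
  - by move=> x y [p ->] [p' ->]; exists (p + p'); rewrite mulrDl /E evD.
  - by move=> k x [p ->]; exists (k *: p); rewrite -scalerAl /E evZ.
  by move=> x y [p ->] [p' ->]; exists (p * 'X * p'); rewrite -EM !mulrA.
(* Since s = (rX)(a), r(a) would invert a; the extra factor rX, that is s, puts the inverse into
   A_1(s). *)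
have ab : a ∘ E (r * (r * 'X)) = s.
  rewrite -[a in LHS]EX -EM (_ : _ * _ = (r * 'X) * (r * 'X)); last by ring.
  by rewrite EM -ds.
have sb : s ∘ E (r * (r * 'X)) = E (r * (r * 'X)).
  rewrite [X in X ∘ _]ds -EM (_ : _ * _ = r * ((r * 'X) * (r * 'X))).
    by rewrite EM (EM (r * 'X)) -ds ss ds -EM.
  by ring.
exists s, (E (r * (r * 'X))); set b := E (r * (r * 'X)) in ab sb *.
have asc x y : (E x ∘ E x) ∘ E y = E x ∘ (E x ∘ E y) by rewrite -!EM mulrA.
split=> //; split=> //.
- by rewrite -[a]EX asc EX ab jmulC.
- by rewrite -[X in _ ∘ X]EX asc EX (jmulC b a) ab jmulC.
by split; [rewrite -[X in opcomm _ X]EX | rewrite -[a]EX -EM]; apply: opcomm_evs.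
Qed.

(* The hypotheses say that b is the inverse of a in A_1(s). *)
Lemma jU_inj s a b x : jidempotent mul s ->
  s ∘ a = a -> s ∘ b = b -> a ∘ b = s -> (a ∘ a) ∘ b = a -> (b ∘ b) ∘ a = b ->
  opcomm b a -> opcomm b (a ∘ a) -> s ∘ x = x -> jU mul a x = 0 -> x = 0.
Proof.
move=> ss sa sb ab aab bba cba cbaa sx; rewrite /jU (jmulC (a ∘ x)) => U0.
have stable c y : s ∘ c = c -> s ∘ y = y -> s ∘ (c ∘ y) = c ∘ y.
  move=> sc sy; have hc : peirce s 1 c by rewrite /peirce scale1r.
  have hy : peirce s 1 y by rewrite /peirce scale1r.
  by rewrite (peirce_mul ss half_neq1 hc hy) scale1r.
(* Multiplying U_a x = 0 by b gives 2 a(b(a x)) = a^2(b x), and [jordan_op] then reads a x = 2 a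
   x. *)
have ax : a ∘ x = 0.
  have H := jordan_op a b a x.
  rewrite aab ab (stable _ _ sa sx) -cba -cbaa in H.
  have H' := congr1 (mul b) U0; rewrite !jmulE in H'.
  clear -H H'; vec.
have aax : (a ∘ a) ∘ x = 0.
  by move: U0; rewrite ax jmul0r scaler0 sub0r => /eqP; rewrite oppr_eq0 => /eqP.
have bx : b ∘ x = 0.
  have H := jordan_op b a b x.
  rewrite bba ax (jmulC b a) ab (stable _ _ sb sx) -cba ax !jmul0r in H.
  clear -H; vec.
(* Here ((a ∘ a) ∘ b) ∘ b = s, and every term except s x = x vanishes. *)
have := jordan_op (a ∘ a) b b x.
by rewrite aab ab sx bx aax !jmul0r !addr0.
Qed.

(** As a and a^2 lie in A_1(s), U_a preserves the Peirce spaces of s; so U_a kills the A_1(s)-part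
    of x, on which it is injective. *)
Lemma jU_support a x : jU mul a x = 0 ->
  exists s, [/\ jidempotent mul s, s ∘ a = a & comp1 s x = 0].
Proof.
move=> U0; have [s [b [ss sa sb [ab aab bba [cba cbaa]]]]] := support_inv a.
exists s; split=> //; set x1 := comp1 s x; set xh := comph s x.
set x0 := comp0 s x; have dx : x = x1 + xh + x0 := peirce_dec ss x.
have h1 : peirce s 1 x1 := peirce_comp1 ss x.
have hh : peirce s 2^-1 xh := peirce_comph ss x.
have h0 : peirce s 0 x0 := peirce_comp0 ss x.
clearbody x1 xh x0.
apply: (jU_inj ss sa sb ab aab bba cba cbaa); first by rewrite h1 scale1r.
have ha : peirce s 1 a by rewrite /peirce scale1r.
have haa := peirce_mul ss half_neq1 ha ha.
have jU_stable k y : peirce s k y -> peirce s k (jU mul a y).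
  move=> hy; have hay := peirce_mul ss half_neq1 ha hy.
  rewrite /jU (jmulC (a ∘ y)); apply: peirceB.
    exact: peirceZ (peirce_mul ss half_neq1 ha hay).
  exact: (peirce_mul ss half_neq1 haa hy).
have dU : jU mul a x = jU mul a x1 + jU mul a xh + jU mul a x0.
  rewrite /jU dx !jmulDr !jmulDl; clear; vec.
have := comp1E ss (jU_stable _ _ h1) (jU_stable _ _ hh) (jU_stable _ _ h0).
by rewrite -dU U0 /comp1 !jmul0r scaler0 subr0 => <-.
Qed.

(** * The Baer condition *)

Lemma nilfree_baer : is_baer mul.
Proof.
move=> S Ssq.
pose T t := jidempotent mul t /\ exists y, [/\ S (y ∘ y), t ∘ y = y &
  forall V, subalg V -> V (y ∘ y) -> V t].
pose N b := forall t, T t -> peirce t 0 b.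
have [|e [ee Ne eN]] := @subalg_unit N.
  split.
  - by move=> t [tt _]; case: (subalg_peirce tt (or_introl erefl)).
  - by move=> x y hx hy t Tt; apply: peirceD; [apply: hx | apply: hy].
  - by move=> k x hx t Tt; apply: peirceZ; apply: hx.
  move=> x y hx hy t Tt; have [tt _] := Tt.
  by apply: (peirce_mul tt half_neq0); [apply: hx | apply: hy].
exists e => //; apply/seteqP; split=> [a Sa|_ [b _ <-] x Sx].
  exists a => //; rewrite jU_idem /comp1 //.
  (* With s the support of a, s y = 0 puts y^2 and hence its support t into A_0(s), whereas a is in
     A_1(s). *)
  suff Na : N a by rewrite !(eN _ Na); clear; vec.
  move=> t [tt [y [Sy ty tV]]].
  have [s [ss sa sy]] := jU_support (Sa _ Sy).
  have {}sy : peirce s 0 y by rewrite /peirce scale0r; apply: idem_annihilates.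
  have st : peirce s 0 t.
    apply: tV; first by apply: subalg_peirce => //; left.
    exact: (peirce_mul ss half_neq0).
  have ha : peirce s 1 a by rewrite /peirce scale1r.
  by rewrite /peirce jmulC (peirce10 ss ha st) scale0r.
(* Conversely, e in A_0(t) and y in A_1(t) give e y = 0, so x = y^2 is in A_0(e) and is annihilated
   by A_1(e). *)
have [y _ dx] := Ssq _ Sx; have [t [tt ty tV]] := support y.
have te : peirce t 0 e by apply: Ne; split=> //; exists y; split=> //; rewrite dx.
have hy : peirce t 1 y by rewrite /peirce scale1r.
have ey : peirce e 0 y by rewrite /peirce jmulC (peirce10 tt hy te) scale0r.
have ex : peirce e 0 x by rewrite -dx; apply: (peirce_mul ee half_neq0).
have ha : peirce e 1 (jU mul e b) by rewrite jU_idem //; apply: peirce_comp1.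
set a := jU mul e b in ha *.
have haa := peirce_mul ee half_neq1 ha ha.
rewrite /jU (peirce10 ee ha ex) (peirce10 ee haa ex).
by rewrite jmul0l scaler0 subr0.
Qed.

End Jordan.

(* R : realType is the field of real numbers, A : vectType R makes A
   finite-dimensional. *)
Theorem corollary3p6 (R : realType) (A : vectType R)
    (mul : {bilinear A -> A -> A}) :
  is_jordan mul -> is_unital mul ->
  (forall a : A, jnilpotent mul a -> a = 0) ->
  is_baer mul.
Proof.
move=> J [u hu] nil; apply: (@nilfree_baer _ _ _ J _ u) => [x xx0|x].
  by apply: nil; exists 2.
by case: (hu x).
Qed.
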